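(* Let $K$ be a field, let $f = x^C(x^A - \rho x^B) \in K[x_1,\dots,x_n]$ with $\rho \in K^\times$ and $A,B,C \in \mathbb{Z}_{\ge 0}^n$ such that $A_iB_i = 0$ for all $i \in \{1,\dots,n\}$, and set $g := x^A - \rho x^B$. Suppose that $f$ satisfies condition (N) of the context, and let $I \subseteq \{1,\dots,n\}$ be such that $$\min\Big\{\sum_{i\in I}A_i,\ \sum_{i\in I}B_i\Big\} = \min\{|A|,|B|\}$$ and $$\forall\, j \in I:\quad \min\Big\{\sum_{i\in I\setminus\{j\}}A_i,\ \sum_{i\in I\setminus\{j\}}B_i\Big\} < \min\{|A|,|B|\}.$$ Let $\pi : \mathrm{Bl}_{D_I}(\mathbb{A}^n_K) \to \mathbb{A}^n_K$ be the blowup with center $D_I := V(x_i \mid i \in I)$. Then in every standard chart $D_+(X_j) \cong \mathbb{A}^n_K$, $j \in I$, with coordinates $x' = (x_1',\dots,x_n')$, writing the total transform of $f$ as $x'^{C'}(x'^{A'} - \rho x'^{B'})$ with $A_i'B_i' = 0$ for all $i$ and setting $g' := x'^{A'} - \rho x'^{B'}$, we have $$\mathrm{inv}(g') <_{\mathrm{lex}} \mathrm{inv}(g).$$ In particular, the local monomialization process terminates if in every non-final chart, with data $(A,B,C)$, the center is chosen as $D_I = V(x_i \mid i\in I)$ for an arbitrary set $I \subseteq \{1,\dots,n\}$ satisfying $\min\{\sum_{i\in I}A_i, \sum_{i\in I}B_i\} = \min\{|A|,|B|\}$ and $\min\{\sum_{i\in I\setminus\{j\}}A_i, \sum_{i\in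 I\setminus\{j\}}B_i\} < \min\{|A|,|B|\}$ for all $j \in I$.
   Context: Notation: for $A=(A_1,\dots,A_n)\in\mathbb{Z}_{\ge0}^n$, $x^A := x_1^{A_1}\cdots x_n^{A_n}$ and $|A| := \sum_{i=1}^n A_i$. Invariant: for $g = x^A - \rho x^B$ as in the claim, $\mathrm{inv}(g) := (\min\{|A|,|B|\},\ \max\{|A|,|B|\}) \in \mathbb{Z}_{\ge 0}^2$, with $\mathbb{Z}_{\ge0}^2$ ordered lexicographically. Conditions: for $f = x^C(x^A - \rho x^B)$ with $A_iB_i=0$ for all $i$, condition (M) is: either $\min\{|A|,|B|\} = 0$, or there is an index $i$ with $C_i = 0$ such that ($|A| = 1$ and $A_i = 1$) or ($|B|=1$ and $B_i=1$). Condition (N) is the negation of (M): either $\min\{|A|,|B|\}\ge 2$, or $\min\{|A|,|B|\} = 1$ and $C_i \ne 0$ for every $i$ such that ($|A|=1$ and $A_i=1$) or ($|B|=1$ and $B_i = 1$). (If (M) holds, then $f$ is locally a monomial, i.e. at every point it is a monomial times a unit in a suitable regular system of parameters.) Blowup charts: for $I\subseteq\{1,\dots,n\}$ the blowup of $\mathbb{A}^n_K$ in $V(x_i\mid i\in I)$ is covered by charts $D_+(X_j)\cong \mathbb{A}^n_K$, $j\in I$, on which it is given by $x_k\mapsto x_j'x_k'$ for $k\in I\setminus\{j\}$ and $x_k\mapsto x_k'$ for $k=j$ or $k\notin I$. The total transform of $f$ in the chart is its image in $K[x']$. On exponents, with $\delta := \min\{\sum_{k\in I}A_k,\sum_{k\in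 I}B_k\}$, one has $A'_j = \sum_{k\in I}A_k - \delta$, $B'_j=\sum_{k\in I}B_k-\delta$, $C'_j = \sum_{k\in I}C_k+\delta$, and all other entries of $A,B,C$ are unchanged. Local monomialization process: start with the chart $\mathbb{A}^n_K$ and $f$. If the data $(A,B,C)$ of a chart satisfies (M), the chart is final. Otherwise choose a center $D_I$ by the given rule applied to that chart's $(A,B,C)$ (independently of the other charts), blow up, and continue in each chart $D_+(X_j)$, $j\in I$, with the total transform $x'^{C'}(x'^{A'}-\rho x'^{B'})$. The process terminates if the resulting tree of charts is finite (so that all its leaves satisfy (M)), whatever choices of centers are made. *)

(* Defs.v *)
From mathcomp Require Import all_boot all_order all_algebra.
From mathcomp Require Import mpoly.

Set Implicit Arguments.
Unset Strict Implicit.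
Unset Printing Implicit Defensive.

Import Order.TTheory GRing.Theory.
Local Open Scope ring_scope.

Record expdata (n : nat) := ExpData {
  expA : 'X_{1..n};
  expB : 'X_{1..n};
  expC : 'X_{1..n} }.

Definition coprime_exps n (d : expdata n) : Prop :=
  forall i : 'I_n, (expA d i * expB d i = 0)%N.

(* x^C (x^A - rho x^B) *)
Definition binomial_of (K : fieldType) n (rho : K) (d : expdata n) :
    {mpoly K[n]} :=
  'X_[expC d] * ('X_[expA d] - rho *: 'X_[expB d]).

Definition mindeg n (d : expdata n) : nat := minn (mdeg (expA d)) (mdeg (expB d)).
Definition maxdeg n (d : expdata n) : nat := maxn (mdeg (expA d)) (mdeg (expB d)).

(* The type [nat *l nat] carries the lexicographic order. *)
Definition binom_inv n (d : expdata n) : nat *l nat := (mindeg d, maxdeg d).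

Definition degree_one_at n (d : expdata n) (i : 'I_n) : bool :=
  (mdeg (expA d) == 1%N) && (expA d i == 1%N)
  || (mdeg (expB d) == 1%N) && (expB d i == 1%N).

Definition condM n (d : expdata n) : bool :=
  (mindeg d == 0%N) || [exists i, (expC d i == 0%N) && degree_one_at d i].

Definition condN n (d : expdata n) : bool := ~~ condM d.

Lemma condNP n (d : expdata n) :
  condN d <-> (2 <= mindeg d)%N \/
              (mindeg d = 1%N /\
               forall i, degree_one_at d i -> expC d i <> 0%N).
Proof.
rewrite /condN /condM negb_or negb_exists; split.
  case/andP=> m0 /forallP H; have [|m1] := leqP 2 (mindeg d); first by left.
  right; split; first by move: m0 m1; case: (mindeg d) => [|[|]].
  by move=> i di Ci; move: (H i); rewrite di Ci.
case=> [m2|[m1 H]].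
  apply/andP; split; first by case: (mindeg d) m2.
  apply/forallP=> i; rewrite negb_and; apply/orP; right.
  move: m2; rewrite /mindeg leq_min => /andP[a2 b2]; rewrite /degree_one_at.
  by rewrite (gtn_eqF a2) (gtn_eqF b2).
rewrite m1 /=; apply/forallP=> i; rewrite negb_and.
by case di: (degree_one_at d i); rewrite ?orbT // orbF; apply/eqP/H.
Qed.

Definition mindeg_on n (d : expdata n) (I : {set 'I_n}) : nat :=
  minn (\sum_(i in I) expA d i)%N (\sum_(i in I) expB d i)%N.

(* The conditions under which D_I = V(x_i | i in I) may be taken as center. *)
Definition admissible n (d : expdata n) (I : {set 'I_n}) : Prop :=
  mindeg_on d I = mindeg d /\
  forall j, j \in I -> (mindeg_on d (I :\ j) < mindeg d)%N.

(* The rule can always be followed, so quantifying over the choices of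
   admissible centers is never vacuous. *)
Lemma admissible_exists n (d : expdata n) : exists I, admissible d I.
Proof.
pose P (I : {set 'I_n}) := mindeg_on d I == mindeg d.
have PT : P setT.
  apply/eqP; rewrite /mindeg_on /mindeg !mdegE.
  by congr minn; apply: eq_bigl => i; rewrite inE.
have [I /minsetP[/eqP PI Imin] _] := minset_exists PT.
exists I; split=> // j jI; rewrite ltn_neqAle; apply/andP; split.
  apply/negP=> PIj; have /setP/(_ j) := Imin _ PIj (subsetDl _ _).
  by rewrite !inE eqxx jI.
rewrite -PI /mindeg_on leq_min !geq_min.
by rewrite !(big_setD1 j jI) /= !leq_addl !orbT.
Qed.

(* The blowup of affine n-space in D_I, read in the chart D_+(X_j), j in I, as
   the K-algebra morphism x_k |-> x'_j x'_k for k in I \ {j} and x_k |-> x'_k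
   for the other k; the value on f is the total transform of f. *)
Definition total_transform (K : fieldType) n (I : {set 'I_n}) (j : 'I_n)
    (f : {mpoly K[n]}) : {mpoly K[n]} :=
  comp_mpoly [tuple (if k \in I :\ j then 'X_j * 'X_k else 'X_k) | k < n] f.

(* The exponents of the total transform in the chart D_+(X_j). *)
Definition chart_exps n (I : {set 'I_n}) (j : 'I_n) (d : expdata n) :
    expdata n :=
  let delta := mindeg_on d I in
  ExpData
    [multinom (if i == j then \sum_(k in I) expA d k - delta else expA d i)%N
      | i < n]
    [multinom (if i == j then \sum_(k in I) expB d k - delta else expB d i)%N
      | i < n]
    [multinom (if i == j then \sum_(k in I) expC d k + delta else expC d i)%N
      | i < n].

Section Process.

Variables (n : nat) (d0 : expdata n).

(* A chart of the process is addressed by the sequence j_1, ..., j_r of the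
   charts D_+(X_j) successively passed to, starting with the root [::].  A run
   is given by the center blown up at each address, so that the choices made in
   different charts are independent even if these have the same exponents.
   [chart_at center p d]: p is the address of a chart of the run, with data d. *)
Inductive chart_at (center : seq 'I_n -> {set 'I_n}) :
    seq 'I_n -> expdata n -> Prop :=
| chart_root : chart_at center [::] d0
| chart_blowup p d j :
    chart_at center p d -> condN d -> j \in center p ->
    chart_at center (rcons p j) (chart_exps (center p) j d).

Definition follows_rule (rule : expdata n -> {set 'I_n} -> Prop)
    (center : seq 'I_n -> {set 'I_n}) : Prop :=
  forall p d, chart_at center p d -> condN d -> rule d (center p).

Definition finite_run (center : seq 'I_n -> {set 'I_n}) : Prop :=
  exists s : seq (seq 'I_n), forall p d, chart_at center p d -> p \in s.

Definition leaves_final (center : seq 'I_n -> {set 'I_n}) : Prop :=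
  forall p d, chart_at center p d ->
    (forall j d', ~ chart_at center (rcons p j) d') -> condM d.

Definition process_terminates (rule : expdata n -> {set 'I_n} -> Prop) : Prop :=
  forall center, follows_rule rule center ->
    finite_run center /\ leaves_final center.

End Process.

(* Main.v *)
Require Import Defs.
From mathcomp Require Import all_boot all_order all_algebra.
From mathcomp Require Import mpoly.
From mathcomp Require Import zify.

(** Let [m = min(|A|, |B|) >= 1] and [j \in I].
    Both sums of exponents over [I] are at least [m], and one of them drops
    below [m] when [j] is removed, so exactly one of [A_j], [B_j] is positive,
    say [A_j].  Then [A'_j = \sum_I A - m < A_j], so [|A|] drops strictly.  If
    [|A| = m], the minimum drops; otherwise [\sum_I B = |B| = m], so [|B|] is
    unchanged, and either the minimum drops or it stays and the maximum drops.
    Since [B'] still has degree at least [|B| > 0], the two monomials of [g']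
    differ, so the total transform determines [{A', B'}]. The process stops because
    the lexicographic order is well founded and every blowup has finitely many
    charts. *)

Import Order.TTheory GRing.Theory.
Local Open Scope ring_scope.

Section Blowup.

Set Implicit Arguments.
Unset Strict Implicit.

Context {n : nat}.
Implicit Types (d e : expdata n) (I : {set 'I_n}) (i j : 'I_n).
Implicit Types (m : 'X_{1..n}) (center : seq 'I_n -> {set 'I_n}).

Lemma mdeg_split m j : mdeg m = (m j + \sum_(i | i != j) m i)%N.
Proof. by rewrite mdegE (bigD1 j). Qed.

Lemma leq_sum_punctured m I j :
  (\sum_(i in I :\ j) m i <= \sum_(i | i != j) m i)%N.
Proof.
rewrite [leqRHS](bigID (mem I)) /=; apply: leq_trans (leq_addr _ _).
by rewrite leq_eqVlt; apply/orP; left; apply/eqP/eq_bigl => i; rewrite !inE.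
Qed.

Lemma mdeg_set_entry m j k :
  mdeg [multinom (if i == j then k else m i)%N | i < n]
    = (k + \sum_(i | i != j) m i)%N.
Proof.
rewrite (mdeg_split _ j) mnmE eqxx; congr addn.
by apply: eq_bigr => i /negbTE ij; rewrite mnmE ij.
Qed.

(** Only entry [j] changes, and subtracting the smaller of the two sums leaves a zero on one
    side. *)
Lemma coprime_chart_exps d I j :
  coprime_exps d -> coprime_exps (chart_exps I j d).
Proof.
move=> cd i; rewrite !mnmE; case: ifP => // _; rewrite /mindeg_on.
by case: leqP; lia.
Qed.

Lemma condN_mindeg d : condN d -> (0 < mindeg d)%N.
Proof. by rewrite lt0n /condN negb_or => /andP[]. Qed.

Lemma coprime_exps_neq d :
  coprime_exps d -> (0 < maxdeg d)%N -> expA d != expB d.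
Proof.
move=> cd; apply: contraTneq => AB; rewrite /maxdeg AB maxnn -eqn0Ngt mdeg_eq0.
by apply/eqP/mnmP => i; have := cd i; rewrite AB mnm0E; lia.
Qed.

Lemma admissible_chart_inv d I j :
    coprime_exps d -> condN d -> admissible d I -> j \in I ->
  (0 < maxdeg (chart_exps I j d))%N /\
  (binom_inv (chart_exps I j d) < binom_inv d)%O.
Proof.
move=> cd /condN_mindeg + [+ Ij] jI; move: (cd j) (Ij j jI) => {cd Ij}.
have := leq_sum_punctured (expA d) I j; have := leq_sum_punctured (expB d) I j.
rewrite /binom_inv ltxi_pair.
rewrite /mindeg /maxdeg /mindeg_on /= !mdeg_set_entry /mindeg_on.
rewrite !(big_setD1 j jI) /= (mdeg_split (expA d) j) (mdeg_split (expB d) j).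
rewrite leEnat ltEnat /=.
(* With entry [j] split off from every sum, only linear arithmetic remains: [sa <= ra], [sb <= rb],
   and [a] or [b] is zero. *)
move: (\sum_(i in I :\ j) expA d i)%N (\sum_(i in I :\ j) expB d i)%N => sa sb.
move: (\sum_(i | i != j) expA d i)%N (\sum_(i | i != j) expB d i)%N => ra rb.
move: (expA d j) (expB d j) => a b rb_ge ra_ge /eqP; rewrite muln_eq0.
by case/orP=> /eqP->; lia.
Qed.

Lemma total_transformX (K : fieldType) I j m : j \in I ->
  total_transform I j ('X_[m] : {mpoly K[n]}) =
    'X_[[multinom (if i == j then \sum_(k in I) m k else m i)%N | i < n]].
Proof.
move=> jI; rewrite /total_transform comp_mpolyX [RHS]mpolyXE_id.
(* Separating the factors ['X_j] contributed by [I :\ j] lets them be collected into one power,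
   which joins the original power of ['X_j]. *)
transitivity (\prod_(k < n) ((if k \in I :\ j then 'X_j ^+ m k else 1) *
                             ('X_k : {mpoly K[n]}) ^+ m k)).
  apply: eq_bigr => k _; rewrite tnth_mktuple.
  by case: ifP; rewrite ?exprMn ?mul1r.
rewrite big_split -big_mkcond -expr_sum /= [X in _ * X](bigD1 j) //=.
rewrite mulrA -exprD.
rewrite [RHS](bigD1 j) //= mnmE eqxx (big_setD1 j jI) addnC; congr (_ * _).
by apply: eq_bigr => k /negbTE kj; rewrite mnmE kj.
Qed.

Lemma binomial_ofE (K : fieldType) (rho : K) d :
  binomial_of rho d = 'X_[expC d + expA d] - rho *: 'X_[expC d + expB d].
Proof. by rewrite /binomial_of mulrBr -scalerAr !mpolyXD. Qed.

Lemma total_transform_binomial (K : fieldType) (rho : K) d I j : j \in I ->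
  total_transform I j (binomial_of rho d) = binomial_of rho (chart_exps I j d).
Proof.
move=> jI; rewrite !binomial_ofE.
have -> : total_transform I j
      ('X_[expC d + expA d] - rho *: 'X_[expC d + expB d]) =
    total_transform I j 'X_[expC d + expA d] -
    rho *: total_transform I j 'X_[expC d + expB d].
  by rewrite /total_transform linearB linearZ.
rewrite !total_transformX //; congr ('X_[_] - rho *: 'X_[_]);
  apply/mnmP => i; rewrite !mnmE; case: ifP => // _.
all: under eq_bigr do rewrite mnmDE.
all: by rewrite big_split /= /mindeg_on -addnA subnKC ?geq_minl ?geq_minr.
Qed.

(** The two monomials of [d] are distinct with coefficients [1] and [- rho], both nonzero, so each
    occurs in [e]. The exchanged alternative does arise, when [rho = -1]. *)
Lemma binomial_of_inj (K : fieldType) (rho : K) d e :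
    rho != 0 -> coprime_exps d -> coprime_exps e -> expA d != expB d ->
    binomial_of rho d = binomial_of rho e ->
  (expA d = expA e /\ expB d = expB e) \/ (expA d = expB e /\ expB d = expA e).
Proof.
move=> rho0 cd ce AB; rewrite !binomial_ofE => eq_de.
have coef m : (expC d + expA d == m)%MM%:R - rho * (expC d + expB d == m)%MM%:R
    = (expC e + expA e == m)%MM%:R - rho * (expC e + expB e == m)%MM%:R.
  by have := congr1 (mcoeff m) eq_de; rewrite !mcoeffB !mcoeffZ !mcoeffX.
have neqd : (expC d + expA d == expC d + expB d)%MM = false.
  by apply: contraNF AB => /eqP/addmI->.
have PA : (expC e + expA e == expC d + expA d)%MM
          || (expC e + expB e == expC d + expA d)%MM.
  have := coef (expC d + expA d)%MM; rewrite eqxx (eq_sym (_ + expB d)%MM) neqd.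
  case: eqP => // _; case: eqP => // _.
  by move/eqP; rewrite mulr0 !subr0 oner_eq0.
have PB : (expC e + expA e == expC d + expB d)%MM
          || (expC e + expB e == expC d + expB d)%MM.
  have := coef (expC d + expB d)%MM; rewrite eqxx neqd.
  case: eqP => // _; case: eqP => // _.
  by move/eqP; rewrite mulr0 subr0 sub0r mulr1 oppr_eq0 (negbTE rho0).
(* Coprimality recovers the common factor: its exponent at [i] is the minimum of the exponents of
   the two monomials at [i]. *)
have agree (m1 m2 : 'X_{1..n}) : (forall i, m1 i * m2 i = 0)%N ->
    (expC d + expA d = expC e + m1)%MM -> (expC d + expB d = expC e + m2)%MM ->
  expA d = m1 /\ expB d = m2.
  move=> c12 eA eB.
  have eAB i : expA d i = m1 i /\ expB d i = m2 i.
    have := congr1 (fun m : 'X_{1..n} => m i) eA; rewrite /= !mnmDE.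
    have := congr1 (fun m : 'X_{1..n} => m i) eB; rewrite /= !mnmDE.
    have /eqP := cd i; have /eqP := c12 i; rewrite !muln_eq0.
    by do 2![case/orP=> /eqP->]; lia.
  by split; apply/mnmP => i; case: (eAB i).
case/orP: PA => /eqP eA; case/orP: PB => /eqP eB.
- by move: neqd; rewrite -eA -eB eqxx.
- by left; apply: agree.
- by right; apply: agree => // i; rewrite mulnC.
- by move: neqd; rewrite -eA -eB eqxx.
Qed.

(** Addresses grow at the right end, so letters of [q] are peeled off from the right until [j] is
    the last one. *)
Lemma chart_at_cons d center p j q e :
    chart_at d center (p ++ j :: q) e ->
  exists e', [/\ chart_at d center p e', condN e' & j \in center p].
Proof.
elim/last_ind: q e => [|q k IHq] e.
  rewrite cats1; move E: (rcons p j) => r H; case: H E => [|p' e' j' H N jI].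
    by case: p.
  by move/rcons_inj => [-> ->]; exists e'.
rewrite -rcons_cons -rcons_cat; move E: (rcons _ k) => r H.
case: H E => [|p' e' j' H _ _]; first by case: (p).
by move/rcons_inj => [Ep _]; apply: IHq; rewrite Ep; exact: H.
Qed.

(** The center depends on the address alone, so the address determines every blowup leading to the
    chart. *)
Lemma chart_at_inj d center p e1 e2 :
  chart_at d center p e1 -> chart_at d center p e2 -> e1 = e2.
Proof.
move=> H1; elim: H1 e2 => [|p' e j _ IH _ _] e2.
  move E: [::] => r H; case: H E => // q e' j' _ _ _.
  by case: q.
move E: (rcons p' j) => r H; case: H E => [|q e' j' H _ _]; first by case: (p').
by move/rcons_inj => [Ep ->]; rewrite Ep (IH e') // Ep.
Qed.

Lemma chart_at_coprime d center p e :
  coprime_exps d -> chart_at d center p e -> coprime_exps e.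
Proof.
by move=> cd; elim=> // {}p {}e j _ ce _ _; apply: coprime_chart_exps.
Qed.

(** Lexicographic induction as two nested ones: the outer bounds [mindeg e], the inner bounds
    [maxdeg e] while keeping the outer bound. *)
Lemma subtree_finite d center p e :
    coprime_exps d -> follows_rule d (@admissible n) center ->
    chart_at d center p e ->
  exists s : seq (seq 'I_n),
    forall q e', chart_at d center (p ++ q) e' -> p ++ q \in s.
Proof.
move=> cd rule.
have [k] := ubnP (mindeg e); elim: k => // k IHk in p e *.
have [l] := ubnP (maxdeg e); elim: l => // l IHl in p e *.
move=> le_l le_k H.
have [N|M] := boolP (condN e); last first.
  exists [:: p] => -[|j q] e' H'; first by rewrite cats0 inE.
  have [e1 [H1 N1 _]] := chart_at_cons H'.
  by rewrite -(chart_at_inj H1 H) N1 in M.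
(* The membership [j \in center p] is kept inside the existential so that a list can be chosen for
   every [j : 'I_n] at once. *)
have child j : exists s : seq (seq 'I_n), forall q e',
    j \in center p -> chart_at d center (rcons p j ++ q) e' ->
    rcons p j ++ q \in s.
  have [jI|jI] := boolP (j \in center p); last by exists [::].
  have Hj := chart_blowup H N jI.
  have [_] := admissible_chart_inv (chart_at_coprime cd H) N (rule _ _ H N) jI.
  rewrite ltxi_pair leEnat ltEnat /= => /andP[le_min lt_max].
  have [lt_min|ge_min] := ltnP (mindeg (chart_exps (center p) j e)) (mindeg e).
    have [|s Hs] := IHk _ _ _ Hj; first by lia.
    by exists s => q e' _; apply: Hs.
  have [||s Hs] := IHl _ _ _ _ Hj.
  - by move: lt_max; rewrite ge_min /=; lia.
  - lia.
  by exists s => q e' _; apply: Hs.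
have {child} [s Hs] := fin_all_exists child.
exists (p :: flatten [seq s j | j : 'I_n]) => -[|j q] e' H'.
  by rewrite cats0 inE eqxx.
have [e1 [_ _ jI]] := chart_at_cons H'.
rewrite inE; apply/orP; right; apply/flatten_mapP; exists j.
  by rewrite mem_enum.
by rewrite -cat_rcons; apply: Hs (jI) _; rewrite cat_rcons; exact: H'.
Qed.

End Blowup.

Theorem proposition3p8 (K : fieldType) (n : nat) (rho : K) (d : expdata n)
    (hrho : rho <> 0%R) (hd : coprime_exps d) :
  (condN d ->
   forall I : {set 'I_n}, admissible d I ->
   forall j : 'I_n, j \in I ->
     (coprime_exps (chart_exps I j d) /\
      total_transform I j (binomial_of rho d) =
        binomial_of rho (chart_exps I j d)) /\
     (forall d' : expdata n,
        coprime_exps d' ->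
        total_transform I j (binomial_of rho d) = binomial_of rho d' ->
        (binom_inv d' < binom_inv d)%O))
  /\ process_terminates d (@admissible n).
Proof.
split=> [N I adm j jI | center rule].
  have cj := coprime_chart_exps I j hd.
  have tt := total_transform_binomial rho d jI.
  split=> // d' cd'; rewrite tt.
  have [max0 lt_inv] := admissible_chart_inv hd N adm jI.
  have AB := coprime_exps_neq cj max0.
  move/(binomial_of_inj (introN eqP hrho) cj cd' AB) => eq_inv.
  (* The invariant is symmetric in the two exponents, so a possible exchange is harmless. *)
  suff <- : binom_inv (chart_exps I j d) = binom_inv d' by [].
  rewrite /binom_inv /mindeg /maxdeg.
  by case: eq_inv => -[-> ->] //; rewrite minnC maxnC.
split=> [|p e H leaf].
  have [s Hs] := subtree_finite hd rule (chart_root d center).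
  by exists s => p e; exact: (Hs p).
(* A leaf violating (M) would have a nonempty center, since the empty one has [mindeg_on] zero; any
   [j] in it gives a child. *)
apply/negPn/negP => N; have [mI _] := rule _ _ H N.
have [I0|[j jI]] := set_0Vmem (center p).
  by move: (condN_mindeg N); rewrite -mI /mindeg_on I0 !big_set0.
exact: leaf (chart_blowup H N jI).
Qed.
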